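(* The cross-product involution on tensors of type $3\times3\times4$ is given as follows. To a 5-uple $(U',W',V,\delta',\mathcal{B})$, where $U',W'$ are $3$-dimensional vector spaces, $V$ is a $4$-dimensional vector space, $\mathcal{B}\in\mathrm{Hom}(W'\otimes V^\vee,U')=W'^\vee\otimes V\otimes U'$, and $\delta':\Lambda^3W'\cong\mathbb{C}$ is an isomorphism, one associates the 5-uple $(U,W,V^\vee,\delta,B)$, where: (1) $W:=\Lambda^2W'$ and, since $W$ is then canonically isomorphic to $W'^\vee$ by the duality $W'\otimes\Lambda^2W'\to\mathbb{C}$ induced by $\delta'$, one lets $\delta:=\delta'^\vee$; (2) $U:=\ker[\tilde B:\Lambda^2W'\otimes V^\vee\to U'\otimes W']$, where $\tilde B$ is the contraction with $\mathcal{B}$ (defined in the context); (3) $B\in\mathrm{Hom}(U\otimes V,W)=W\otimes V^\vee\otimes U^\vee$ is the composition of the inclusion $U\otimes V\hookrightarrow\Lambda^2W'\otimes V^\vee\otimes V$ with the natural contraction $V^\vee\otimes V\to\mathbb{C}$. The dimension of $U$ is equal to three under the main assumption: $\tilde B$ is surjective. The main assumption in turn implies the injectivity of the map $\mathcal{B}:U'^\vee\to V\otimes W$. The cross-product involution is then defined, through the associated 5-uple, on the open set of tensors satisfying the main assumption, and it is involutive whenever the composition is defined.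
   Context: All vector spaces are over $\mathbb{C}$. The map $\tilde B:\Lambda^2W'\otimes V^\vee\to U'\otimes W'$ is the composition of the natural inclusion $\Lambda^2W'\otimes V^\vee\subset W'\otimes W'\otimes V^\vee$ with the map to $U'\otimes W'$ obtained by applying $\mathcal{B}:W'\otimes V^\vee\to U'$ to one factor $W'$ and $V^\vee$, and the identity on the other factor $W'$. The map $\mathcal{B}:U'^\vee\to V\otimes W$ is the one given by the tensor $\mathcal{B}\in W'^\vee\otimes V\otimes U'$ under the identification $W'^\vee\cong W$ of (1). *)

(* Defs.v *)
From HB Require Import structures.
From mathcomp Require Import all_boot all_order all_algebra.
From mathcomp Require Import reals complex mpoly.

Set Implicit Arguments.
Unset Strict Implicit.
Unset Printing Implicit Defensive.

Import Order.TTheory GRing.Theory Num.Theory.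

Local Open Scope ring_scope.

Reserved Notation "x ⊗ y" (at level 40, left associativity).

Section TensorProduct.
Variable K : numFieldType.
Implicit Types V W Z : vectType K.

Lemma linfunE_linear V W (f : V -> W) : linear f -> linfun f =1 f.
Proof.
move=> lf x; pose h := GRing.isLinear.Build K V W *:%R f lf.
pose F : {linear V -> W} := HB.pack f h.
exact: (lfunE F).
Qed.

Definition vdual V : vectType K := 'Hom(V, K^o).

Definition vdual_ev V : 'Hom(V, vdual (vdual V)) :=
  linfun (fun v : V => linfun (fun f : vdual V => f v) : vdual (vdual V)).

(* V ⊗ W is modelled by the coordinate matrices of tensors in the bases       *)
(* vbasis {:V} and vbasis {:W}; below, it is only used through the pure       *)
(* tensors [tmul] and the universal extension [tlift] of bilinear maps.       *)
Definition tens V W : vectType K := 'M[K]_(\dim {:V}, \dim {:W}).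

Definition tmul V W (v : V) (w : W) : tens V W :=
  \matrix_(i, j) (coord (vbasis {:V}) i v * coord (vbasis {:W}) j w).

Definition tlift V W Z (b : V -> W -> Z) : 'Hom(tens V W, Z) :=
  linfun (fun t : tens V W => \sum_i \sum_j
    (t : 'M[K]_(\dim {:V}, \dim {:W})) i j
      *: b (vbasis {:V})`_i (vbasis {:W})`_j).

Local Notation "x ⊗ y" := (tmul x y) : ring_scope.

Definition tmap V W V2 W2 (f : 'Hom(V, V2)) (g : 'Hom(W, W2)) :
    'Hom(tens V W, tens V2 W2) :=
  tlift (fun v w => f v ⊗ g w).

Definition tlift3 V1 V2 V3 Z (f : V1 -> V2 -> V3 -> Z) :
    'Hom(tens V1 (tens V2 V3), Z) :=
  tlift (fun x t => tlift (f x) t).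

Lemma tmul_bilinear V W :
  bilinear_for *:%R *:%R (@tmul V W).
Proof.
split=> [w|v] a x y; apply/matrixP=> i j; rewrite !mxE !linearP /=.
  by rewrite mulrDl mulrA.
by rewrite mulrDr mulrCA.
Qed.

Lemma tlift_raw_linear V W Z (b : V -> W -> Z) :
  linear (fun t : 'M[K]_(\dim {:V}, \dim {:W}) =>
    \sum_i \sum_j t i j *: b (vbasis {:V})`_i (vbasis {:W})`_j).
Proof.
move=> a s t; rewrite scaler_sumr -big_split /=; apply: eq_bigr => i _.
rewrite scaler_sumr -big_split /=; apply: eq_bigr => j _.
by rewrite !mxE scalerDl scalerA.
Qed.

Lemma tlift_sum V W Z (b : V -> W -> Z) (t : tens V W) :
  tlift b t = \sum_i \sum_j (t : 'M[K]_(\dim {:V}, \dim {:W})) i j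
                 *: b (vbasis {:V})`_i (vbasis {:W})`_j.
Proof.
exact: (linfunE_linear (@tlift_raw_linear V W Z b)).
Qed.

Lemma tliftE V W Z (b : V -> W -> Z) :
  bilinear_for *:%R *:%R b -> forall v w, tlift b (v ⊗ w) = b v w.
Proof.
move=> [bl br] v w; rewrite tlift_sum.
have Fl := linfunE_linear (bl w); have Fr v' := linfunE_linear (br v').
rewrite [in RHS](coord_vbasis (memvf v)) -[RHS]Fl linear_sum.
apply: eq_bigr => i _; rewrite linearZ /= Fl.
rewrite [in RHS](coord_vbasis (memvf w)) -[b _ _ in RHS]Fr linear_sum.
rewrite scaler_sumr; apply: eq_bigr => j _.
by rewrite linearZ /= Fr mxE scalerA.
Qed.

Lemma tens_ext V W Z (f g : 'Hom(tens V W, Z)) :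
  (forall v w, f (v ⊗ w) = g (v ⊗ w)) -> f = g.
Proof.
move=> fg; apply/lfunP => t.
have -> : t = \sum_i \sum_j (t : 'M[K]_(\dim {:V}, \dim {:W})) i j
                 *: ((vbasis {:V})`_i ⊗ (vbasis {:W})`_j).
  apply/matrixP=> i j; rewrite summxE (bigD1 i) //= summxE (bigD1 j) //=.
  have fV := basis_free (vbasisP {:V}); have fW := basis_free (vbasisP {:W}).
  rewrite !mxE !coord_free // !eqxx !mulr1.
  rewrite [X in _ = _ + X + _]big1 => [|k nk]; last first.
    by rewrite !mxE !coord_free // (negPf nk) !mulr0.
  rewrite big1 ?addr0 // => k nk; rewrite summxE big1 // => l _.
  by rewrite !mxE !coord_free // (negPf nk) mul0r mulr0.
by rewrite !linear_sum; apply: eq_bigr => i _; rewrite !linear_sum;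
   apply: eq_bigr => j _; rewrite !linearZ /= fg.
Qed.
Definition trilinear V1 V2 V3 Z (f : V1 -> V2 -> V3 -> Z) : Prop :=
  [/\ forall y z, linear (fun x => f x y z),
      forall x z, linear (fun y => f x y z) & forall x y, linear (f x y)].

Lemma tlift3E V1 V2 V3 Z (f : V1 -> V2 -> V3 -> Z) : trilinear f ->
  forall x y z, tlift3 f (x ⊗ (y ⊗ z)) = f x y z.
Proof.
case=> f1 f2 f3 x y z.
have bf x' : bilinear_for *:%R *:%R (f x').
  by split=> ?; [exact: f2 | exact: f3].
rewrite /tlift3 tliftE ?tliftE //; split=> [t|x'] a u v; last exact: linearP.
rewrite /= !tlift_sum scaler_sumr -big_split; apply: eq_bigr => i _.
rewrite scaler_sumr -big_split; apply: eq_bigr => j _ /=.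
by rewrite f1 scalerDr !scalerA [a * _]mulrC.
Qed.

Lemma tens3_ext V1 V2 V3 Z (f g : 'Hom(tens V1 (tens V2 V3), Z)) :
  (forall x y z, f (x ⊗ (y ⊗ z)) = g (x ⊗ (y ⊗ z))) -> f = g.
Proof.
move=> fg; apply: tens_ext => x t.
have L (h : 'Hom(tens V1 (tens V2 V3), Z)) :
    linear (fun t : tens V2 V3 => h (x ⊗ t)).
  by move=> a u v /=; rewrite (tmul_bilinear _ _).2 linearP.
rewrite -(linfunE_linear (L f)) -(linfunE_linear (L g)).
congr (fun_of_lfun _ t); apply: tens_ext => y z.
by rewrite !linfunE_linear.
Qed.

End TensorProduct.

Notation "x ⊗ y" := (tmul x y) : ring_scope.

Section ExteriorPowers.
Variable K : numFieldType.
Implicit Types V W Z : vectType K.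

(* Λ²W and Λ³W are realized inside W ⊗ W and W ⊗ (W ⊗ W) as the images of the *)
(* antisymmetrizers x ⊗ y |-> x ∧ y = x ⊗ y - y ⊗ x, and similarly for three  *)
(* factors, so that [vsval] is the natural inclusion.                         *)
Definition alt2 W : 'End(tens W W) := tlift (fun x y => x ⊗ y - y ⊗ x).

Definition alt3 W : 'End(tens W (tens W W)) :=
  tlift3 (fun x y z =>
      (x ⊗ (y ⊗ z) + y ⊗ (z ⊗ x) + z ⊗ (x ⊗ y))
    - (x ⊗ (z ⊗ y) + z ⊗ (y ⊗ x) + y ⊗ (x ⊗ z))).

Definition ext2 W : vectType K := subvs_of (limg (alt2 W)).
Definition ext3 W : vectType K := subvs_of (limg (alt3 W)).

Definition wedge2 W (x y : W) : ext2 W := vsproj _ (alt2 W (x ⊗ y)).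
Definition wedge3 W (x y z : W) : ext3 W := vsproj _ (alt3 W (x ⊗ (y ⊗ z))).

Definition ext2_incl W : 'Hom(ext2 W, tens W W) :=
  linfun (fun a : ext2 W => vsval a).
Definition ext3_incl W : 'Hom(ext3 W, tens W (tens W W)) :=
  linfun (fun a : ext3 W => vsval a).

(* The linear maps induced by alternating multilinear maps: the preimage      *)
(* under the antisymmetrizer chosen by ^-1 is irrelevant for those.           *)
Definition ext2_lift W Z (f : W -> W -> Z) : 'Hom(ext2 W, Z) :=
  (tlift f \o (alt2 W)^-1 \o ext2_incl W)%VF.
Definition ext3_lift W Z (f : W -> W -> W -> Z) : 'Hom(ext3 W, Z) :=
  (tlift3 f \o (alt3 W)^-1 \o ext3_incl W)%VF.

(* x ∧ a for x in W and a in Λ²W *)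
Definition wedge12 W (x : W) (a : ext2 W) : ext3 W :=
  ext2_lift (fun y z => wedge3 x y z) a.

Lemma ext2_inclE W (a : ext2 W) : ext2_incl W a = vsval a.
Proof. by rewrite /ext2_incl lfunE. Qed.

Lemma ext3_inclE W (a : ext3 W) : ext3_incl W a = vsval a.
Proof. by rewrite /ext3_incl lfunE. Qed.

Lemma ext2_liftE W Z (f : W -> W -> Z) :
    bilinear_for *:%R *:%R f -> (forall x, f x x = 0) ->
  forall x y, ext2_lift f (wedge2 x y) = f x y.
Proof.
move=> fbil falt x y.
have fC u v : f u v = - f v u.
  have [fl fr] := fbil.
  have dl a b c : f (a + b) c = f a c + f b c.
    by have L := linfunE_linear (fl c); rewrite -!L linearD.
  have dr a b c : f a (b + c) = f a b + f a c.
    by have L := linfunE_linear (fr a); rewrite -!L linearD.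
  apply/eqP; rewrite -addr_eq0; apply/eqP.
  have := falt (u + v); rewrite dl !dr !falt add0r addr0; exact.
have tb := @tmul_bilinear K W W.
have altE u v : alt2 W (u ⊗ v) = u ⊗ v - v ⊗ u.
  rewrite /alt2 tliftE //; split=> c a p q /=.
    by rewrite tb.1 tb.2 scalerBr opprD addrACA.
  by rewrite tb.1 tb.2 scalerBr opprD addrACA.
have key : (tlift f \o alt2 W)%VF = 2 *: tlift f.
  apply: tens_ext => u v.
  rewrite comp_lfunE altE linearB /= !tliftE // [f v u]fC opprK.
  by rewrite scale_lfunE tliftE // scaler_nat mulr2n.
have E a : 2 *: tlift f a = tlift f (alt2 W a).
  by rewrite -[RHS]comp_lfunE key scale_lfunE.
rewrite /ext2_lift !comp_lfunE ext2_inclE vsprojK ?memv_img ?memvf //.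
have n2 : (2 : K) != 0 by rewrite pnatr_eq0.
apply: (scalerI n2); rewrite E.
by rewrite limg_lfunVK ?memv_img ?memvf // -E tliftE.
Qed.

Lemma ext3_liftE W Z (f : W -> W -> W -> Z) : trilinear f ->
    (forall x y, [/\ f x x y = 0, f x y y = 0 & f x y x = 0]) ->
  forall x y z, ext3_lift f (wedge3 x y z) = f x y z.
Proof.
move=> ftri falt x y z; have [f1 f2 f3] := ftri.
have D1 a b c d : f (a + b) c d = f a c d + f b c d.
  by have L := linfunE_linear (f1 c d); rewrite -!L linearD.
have D2 a b c d : f c (a + b) d = f c a d + f c b d.
  by have L := linfunE_linear (f2 c d); rewrite -!L linearD.
have D3 a b c d : f c d (a + b) = f c d a + f c d b.
  by have L := linfunE_linear (f3 c d); rewrite -!L linearD.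
have C12 u v w : f v u w = - f u v w.
  apply/eqP; rewrite -addr_eq0 addrC; apply/eqP.
  have [E _ _] := falt (u + v) w; have [Eu _ _] := falt u w.
  by have [Ev _ _] := falt v w; rewrite D1 !D2 Eu Ev add0r addr0 in E.
have C23 u v w : f u w v = - f u v w.
  apply/eqP; rewrite -addr_eq0 addrC; apply/eqP.
  have [_ E _] := falt u (v + w); have [_ Ev _] := falt u v.
  by have [_ Ew _] := falt u w; rewrite D2 !D3 Ev Ew add0r addr0 in E.
have alt3E u v w : alt3 W (u ⊗ (v ⊗ w)) =
      (u ⊗ (v ⊗ w) + v ⊗ (w ⊗ u) + w ⊗ (u ⊗ v))
    - (u ⊗ (w ⊗ v) + w ⊗ (v ⊗ u) + v ⊗ (u ⊗ w)).
  have [tl tr] := @tmul_bilinear K W W; have [ul ur] := @tmul_bilinear K W (tens W W).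
  have E a (p q p' q' : tens W (tens W W)) :
      (a *: p + p') - (a *: q + q') = a *: (p - q) + (p' - q').
    by rewrite scalerBr opprD addrACA.
  have E3 a (p q r p' q' r' : tens W (tens W W)) :
      (a *: p + p') + (a *: q + q') + (a *: r + r')
      = a *: (p + q + r) + (p' + q' + r').
    by rewrite !scalerDr [X in X + _ = _]addrACA [LHS]addrACA.
  rewrite /alt3 tlift3E //; split=> b c a p q /=;
    by rewrite !(tl, tr, ul, ur) E3 E3 E.
have key : (tlift3 f \o alt3 W)%VF = 6 *: tlift3 f.
  apply: tens3_ext => u v w.
  rewrite comp_lfunE alt3E linearB /= !linearD /= !tlift3E // scale_lfunE.
  rewrite tlift3E // scaler_nat.
  have Evwu : f v w u = f u v w by rewrite (C23 v u w) (C12 u v w) opprK.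
  have Ewuv : f w u v = f u v w by rewrite (C12 u w v) (C23 u v w) opprK.
  rewrite (C12 v w u) Evwu Ewuv (C23 u v w) (C12 u v w) !opprK !addrA.
  by rewrite !mulrS mulr0n addr0 !addrA.
have E a : 6 *: tlift3 f a = tlift3 f (alt3 W a).
  by rewrite -[RHS]comp_lfunE key scale_lfunE.
rewrite /ext3_lift !comp_lfunE ext3_inclE vsprojK ?memv_img ?memvf //.
have n6 : (6 : K) != 0 by rewrite pnatr_eq0.
apply: (scalerI n6); rewrite E.
by rewrite limg_lfunVK ?memv_img ?memvf // -E tlift3E.
Qed.

End ExteriorPowers.

Section CrossProduct.
Variable K : numFieldType.

(* A 5-uple (U', W', V, δ', B') with δ' : Λ³W' -> K and B' in                 *)
(* Hom(W' ⊗ V^∨, U') = W'^∨ ⊗ V ⊗ U'.                                         *)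
Record quintuple := Quintuple {
  qU : vectType K;
  qW : vectType K;
  qV : vectType K;
  qdelta : 'Hom(ext3 qW, K^o);
  qB : 'Hom(tens qW (vdual qV), qU) }.

(* A 5-uple (U, W, V^∨, δ, B) with δ : Λ³W -> K and B in                      *)
(* Hom(U ⊗ V, W) = W ⊗ V^∨ ⊗ U^∨; the field dV is V, not V^∨.                 *)
Record dquintuple := DQuintuple {
  dU : vectType K;
  dW : vectType K;
  dV : vectType K;
  ddelta : 'Hom(ext3 dW, K^o);
  dB : 'Hom(tens dU dV, dW) }.

Definition type334 (T : quintuple) : Prop :=
  [/\ \dim {:qU T} = 3%N, \dim {:qW T} = 3%N, \dim {:qV T} = 4%N
    & bijective (qdelta T)].

Definition dtype334 (D : dquintuple) : Prop :=
  [/\ \dim {:dU D} = 3%N, \dim {:dW D} = 3%N, \dim {:vdual (dV D)} = 4%N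
    & bijective (ddelta D)].

(* For a duality p : X x Y -> K between 3-dimensional spaces, the isomorphism *)
(* Λ³Y = (Λ³X)^∨ -> K inverse to the dual K -> (Λ³X)^∨ of δ, where Λ³Y and    *)
(* (Λ³X)^∨ are identified through the determinant of p.                       *)
Definition det_pairing (X Y : vectType K) (p : X -> Y -> K) :
    'Hom(ext3 Y, vdual (ext3 X)) :=
  ext3_lift (fun y0 y1 y2 : Y =>
    ext3_lift (fun x0 x1 x2 : X =>
      \det (\matrix_(i < 3, j < 3)
              p (tnth [tuple x0; x1; x2] i) (tnth [tuple y0; y1; y2] j)) : K^o)
    : vdual (ext3 X)).

Definition dual_delta (X Y : vectType K) (p : X -> Y -> K)
    (delta : 'Hom(ext3 X, K^o)) : 'Hom(ext3 Y, K^o) :=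
  ((linfun (fun c : K^o => (c : K) *: delta : vdual (ext3 X)))^-1
     \o det_pairing p)%VF.

Section Construction.
Variable T : quintuple.
Local Notation U' := (qU T).
Local Notation W' := (qW T).
Local Notation V := (qV T).
Local Notation delta' := (@qdelta T).
Local Notation B' := (@qB T).

Definition cross_W : vectType K := ext2 W'.

Definition cross_pairing (x : W') (a : cross_W) : K := delta' (wedge12 x a).

Definition cross_W_duality : 'Hom(cross_W, vdual W') :=
  linfun (fun a : cross_W =>
    linfun (fun x : W' => cross_pairing x a : K^o) : vdual W').

Definition cross_W_codual : 'Hom(W', vdual cross_W) :=
  linfun (fun x : W' =>
    linfun (fun a : cross_W => cross_pairing x a : K^o) : vdual cross_W).

Definition cross_delta : 'Hom(ext3 cross_W, K^o) :=
  dual_delta cross_pairing delta'.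

Definition Btilde : 'Hom(tens (ext2 W') (vdual V), tens U' W') :=
  (tlift (fun (t : tens W' W') (xi : vdual V) =>
            tlift (fun x y : W' => B' (x ⊗ xi) ⊗ y) t)
     \o tmap (ext2_incl W') \1)%VF.

Definition main_assumption : Prop := limg Btilde = fullv.

Definition cross_U : vectType K := subvs_of (lker Btilde).

Definition cross_B : 'Hom(tens cross_U V, cross_W) :=
  tlift (fun (u : cross_U) (v : V) =>
    tlift (fun (a : cross_W) (xi : vdual V) => (xi v : K) *: a) (vsval u)).

Definition cross : dquintuple :=
  @DQuintuple cross_U cross_W V cross_delta cross_B.

(* V ⊗ W = (W' ⊗ V^∨)^∨, from the duality between W and W' *)
Definition VW_dual : 'Hom(tens V cross_W, vdual (tens W' (vdual V))) :=
  tlift (fun (v : V) (a : cross_W) =>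
    tlift (fun (x : W') (xi : vdual V) => (xi v : K) * cross_pairing x a : K^o)
    : vdual (tens W' (vdual V))).

Definition B_flat : 'Hom(vdual U', tens V cross_W) :=
  ((VW_dual)^-1
     \o linfun (fun b : vdual U' => (b \o B')%VF : vdual (tens W' (vdual V))))%VF.

End Construction.

(* (U, W, V^∨, δ, B) read as a 5-uple of the initial kind: as W = (W^∨)^∨, the *)
(* tensor B in W ⊗ V^∨ ⊗ U^∨ is an element of Hom(W^∨ ⊗ (V^∨)^∨, U^∨).        *)
Definition undual (D : dquintuple) : quintuple :=
  @Quintuple (vdual (dU D)) (vdual (dW D)) (vdual (dV D))
    (dual_delta (fun (a : dW D) (w : vdual (dW D)) => w a) (@ddelta D))
    (tlift (fun (w : vdual (dW D)) (z : vdual (vdual (dV D))) =>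
       linfun (fun u : dU D =>
         z (linfun (fun v : dV D => w (@dB D (u ⊗ v))) : vdual (dV D)))
       : vdual (dU D))).

Definition cross_involution (T : quintuple) : quintuple := undual (cross T).

Definition quintuple_iso (T1 T2 : quintuple) (f : 'Hom(qU T1, qU T2))
    (g : 'Hom(qW T1, qW T2)) (h : 'Hom(qV T1, qV T2)) : Prop :=
  [/\ [/\ bijective f, bijective g & bijective h],
      forall x y z, @qdelta T2 (wedge3 (g x) (g y) (g z))
                    = @qdelta T1 (wedge3 x y z)
    & forall (x : qW T1) (xi : vdual (qV T2)),
        @qB T2 (g x ⊗ xi) = f (@qB T1 (x ⊗ (xi \o h)%VF))].

(* The identification of W' with the W'-component of the 5-uple obtained by   *)
(* applying the construction twice: W' = (Λ²W')^∨ at each step.               *)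
Definition cross2_W (T : quintuple) :
    'Hom(qW T, qW (cross_involution (cross_involution T))) :=
  (cross_W_codual (cross_involution T) \o cross_W_codual T)%VF.

Definition cross2_V (T : quintuple) :
    'Hom(qV T, qV (cross_involution (cross_involution T))) :=
  vdual_ev (qV T).

End CrossProduct.

Arguments Quintuple {K qU qW qV}.

Definition zariski_open (K : fieldType) (X : vectType K) (S : X -> Prop) :=
  exists ps : seq {mpoly K[\dim {:X}]}, forall x : X,
    S x <-> exists2 p, p \in ps & p.@[fun i => coord (vbasis {:X}) i x] != 0.

(* Main.v *)
Require Import Defs.
From mathcomp Require Import all_boot all_order all_algebra.
From mathcomp Require Import reals complex mpoly ring.
Import GRing.Theory.
Local Open Scope ring_scope.

Set Implicit Arguments.
Unset Strict Implicit.
Unset Printing Implicit Defensive.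

(* Fix a basis e_0, e_1, e_2 of W' of volume 1 and the basis                  *)
(* a_i = e_{i+1} ∧ e_{i+2} of Λ²W', dual to it. A tensor Σ a_i ⊗ ξ_i of       *)
(* Λ²W' ⊗ V^∨ lies in U if and only if                                        *)
(* B'(e_i ⊗ ξ_j) = B'(e_j ⊗ ξ_i) for all i, j. After one step the basis of    *)
(* the new W' is again (e_i), now seen in (Λ²W')^∨, and the new tensor is     *)
(* e_i ⊗ z |-> (Σ a_j ⊗ ξ_j |-> z(ξ_i)). A linear form b on U' gives          *)
(* z_i := b(B'(e_i ⊗ _)) in V^∨∨, and the equations of U say precisely that   *)
(* z_i(ξ_j) = z_j(ξ_i) on U, i.e., that Σ a_i ⊗ z_i lies in the second        *)
(* kernel. This map from U'^∨ to the second kernel is injective because the   *)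
(* main assumption makes B' surjective; since both sides have dimension 3 it  *)
(* is an isomorphism, whose dual identifies U' with its double transform.     *)

(** * Linear algebra and tensor products *)

(** The bases above also give the remaining claims. Under the main assumption, rank-nullity for
    [Btilde], from dimension 12 onto dimension 9, gives U dimension 3 ([dim_cross_U]). If a form b
    on U' vanishes on the image of B', then b ⊗ id kills the image of [Btilde], which is everything,
    so b = 0 ([qB_separated]). This yields the injectivity of [B_flat] and of the map from U'^∨ to
    the second kernel ([theta]).

    Volume forms are controlled by one principle: for dual bases, if the first has volume 1, so has
    the second for the dual volume form ([dual_deltaE]). Applied twice, it shows that a basis of
    volume 1 of W' is carried to one of (Λ²W')^∨ ([codual_frame]).

    Openness holds because [Btilde] is linear in B' ([Btilde_linear]) and surjectivity of a linear
    map is the non-vanishing of some maximal minor ([zariski_open_surjective]). *)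

Section LinearAlgebra.
Variable K : numFieldType.
Implicit Types X Y Z : vectType K.

Lemma scaleKE (a : K) (c : K^o) : a *: c = a * c :> K. Proof. by []. Qed.

Lemma dim_vdual X : \dim {:vdual X} = \dim {:X}.
Proof. by rewrite !dimvf /dim /= muln1. Qed.

Lemma dim_tens X Y : \dim {:tens X Y} = (\dim {:X} * \dim {:Y})%N.
Proof. by rewrite dimvf dim_matrix. Qed.

Lemma dim_subvs_of X (U : {vspace X}) : \dim {:subvs_of U} = \dim U.
Proof. by rewrite dimvf. Qed.

Lemma injective_bijective X Y (f : 'Hom(X, Y)) :
  \dim {:X} = \dim {:Y} -> injective f -> bijective f.
Proof.
move=> dXY /lker0P kf; have K1 := lker0_lfunK kf.
exists f^-1%VF => // y; apply: limg_lfunVK; suff -> : limg f = fullv by exact: memvf.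
by apply/eqP; rewrite eqEdim subvf -dXY limg_dim_eq ?leqnn //= (eqP kf) capv0.
Qed.

Lemma lfun_inj X Y (f : 'Hom(X, Y)) : (forall x, f x = 0 -> x = 0) -> injective f.
Proof.
by move=> f0 x y E; apply/eqP; rewrite -subr_eq0; apply/eqP/f0; rewrite linearB /= E subrr.
Qed.

Lemma vdual_eq0 X (x : X) : (forall f : vdual X, f x = 0) -> x = 0.
Proof.
move=> f0; rewrite (coord_vbasis (memvf x)) big1 // => i _.
have := f0 (linfun (coord (vbasis {:X}) i : X -> K^o)).
by rewrite lfunE /= => ->; rewrite scale0r.
Qed.

Lemma vdual_evE X (x : X) (f : vdual X) : vdual_ev X x f = f x.
Proof.
rewrite /vdual_ev linfunE_linear => [|a u v].
  by rewrite linfunE_linear // => a u v; rewrite add_lfunE scale_lfunE.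
apply/lfunP => g; rewrite add_lfunE scale_lfunE.
by rewrite !linfunE_linear ?linearP // => b p q; rewrite add_lfunE scale_lfunE.
Qed.

Lemma vdual_ev_bij X : bijective (vdual_ev X).
Proof.
apply: injective_bijective; first by rewrite !dim_vdual.
apply: lfun_inj => x E; apply: vdual_eq0 => f.
by rewrite -vdual_evE E zero_lfunE.
Qed.

Lemma linfun_vdualE X Y (p : X -> Y -> K) :
    (forall y, linear (fun x => p x y : K^o)) ->
    (forall x, linear (fun y => p x y : K^o)) ->
  forall x y,
    (linfun (fun x => linfun (fun y => p x y : K^o) : vdual Y) : 'Hom(X, vdual Y)) x y
    = p x y.
Proof.
move=> pl pr x y; rewrite linfunE_linear ?linfunE_linear // => a u v.
by apply/lfunP => z; rewrite add_lfunE scale_lfunE !linfunE_linear // pl.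
Qed.

Lemma dual_basis_free n X (e : n.-tuple X) (f : 'I_n -> vdual X) :
  (forall i j : 'I_n, f i e`_j = (i == j)%:R) -> free e.
Proof.
move=> fe; apply/freeP => k E i; have /(congr1 (f i)) := E.
rewrite linear0 linear_sum (bigD1 i) //= big1 ?addr0 => [|j ne].
  by rewrite linearZ /= fe eqxx => <-; rewrite [RHS]mulr1.
by rewrite linearZ /= fe eq_sym (negPf ne) [LHS]mulr0.
Qed.

Lemma free_basis_of n X (e : n.-tuple X) : free e -> \dim {:X} = n -> basis_of fullv e.
Proof. by move=> fe dX; rewrite basisEfree fe subvf size_tuple dX leqnn. Qed.

Section Components.
Variables (n : nat) (X Y : vectType K) (e : n.-tuple X).

(* The two component maps are kept behind opaque proofs: unification may       *)
(* otherwise unfold them down to matrix coordinates.                          *)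
Fact lcomp_exists : {h : 'I_n -> 'Hom(tens X Y, Y) |
  forall i x y, h i (x ⊗ y) = coord e i x *: y}.
Proof.
exists (fun i => tlift (fun x y => coord e i x *: y)) => i x y.
rewrite tliftE //; split=> [{}y|{}x] c u v /=.
  by rewrite linearP scalerDl scalerA.
by rewrite scalerDr !scalerA mulrC.
Qed.

Fact rcomp_exists : {h : 'I_n -> 'Hom(tens Y X, Y) |
  forall i x y, h i (y ⊗ x) = coord e i x *: y}.
Proof.
exists (fun i => tlift (fun y x => coord e i x *: y)) => i x y.
rewrite tliftE //; split=> [{}x|{}y] c u v /=.
  by rewrite scalerDr !scalerA mulrC.
by rewrite linearP scalerDl scalerA.
Qed.

Definition lcomp := sval lcomp_exists.
Definition rcomp := sval rcomp_exists.

Lemma lcompE i x y : lcomp i (x ⊗ y) = coord e i x *: y.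
Proof. exact: (svalP lcomp_exists). Qed.

Lemma rcompE i x y : rcomp i (y ⊗ x) = coord e i x *: y.
Proof. exact: (svalP rcomp_exists). Qed.

End Components.

Section TensorLinear.
Variables (X Y : vectType K).

Lemma tmul_linearl (y : Y) : linear (fun x : X => x ⊗ y).
Proof. exact: (tmul_bilinear _ _).1. Qed.

Lemma tmul_linearr (x : X) : linear (fun y : Y => x ⊗ y).
Proof. exact: (tmul_bilinear _ _).2. Qed.

Lemma tmulZl a (x : X) (y : Y) : (a *: x) ⊗ y = a *: (x ⊗ y).
Proof. by apply/matrixP=> i j; rewrite !mxE linearZ /= mulrA. Qed.

Lemma tmulZr a (x : X) (y : Y) : x ⊗ (a *: y) = a *: (x ⊗ y).
Proof. by apply/matrixP=> i j; rewrite !mxE linearZ /= mulrCA. Qed.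

Lemma tmulDl (u v : X) (y : Y) : (u + v) ⊗ y = u ⊗ y + v ⊗ y.
Proof. by rewrite -[u]scale1r tmul_linearl !scale1r. Qed.

Lemma tmulDr (x : X) (u v : Y) : x ⊗ (u + v) = x ⊗ u + x ⊗ v.
Proof. by rewrite -[u]scale1r tmul_linearr !scale1r. Qed.

Lemma tmul0l (y : Y) : (0 : X) ⊗ y = 0.
Proof. by rewrite -(scale0r (0 : X)) tmulZl scale0r. Qed.

Lemma tmul0r (x : X) : x ⊗ (0 : Y) = 0.
Proof. by rewrite -(scale0r (0 : Y)) tmulZr scale0r. Qed.

Lemma tmul_suml I (r : seq I) P (F : I -> X) (y : Y) :
  (\sum_(i <- r | P i) F i) ⊗ y = \sum_(i <- r | P i) F i ⊗ y.
Proof. exact: (big_morph (fun x => x ⊗ y) (fun u v => tmulDl u v y) (tmul0l y)). Qed.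

Lemma tmul_sumr I (r : seq I) P (F : I -> Y) (x : X) :
  x ⊗ (\sum_(i <- r | P i) F i) = \sum_(i <- r | P i) x ⊗ F i.
Proof. exact: (big_morph (tmul x) (tmulDr x) (tmul0r x)). Qed.

Variable n : nat.

(** Both sides are linear in [t], so the expansion need only be checked on pure tensors, where it is
    the expansion of the left factor in the basis. *)
Lemma tens_lcomp (e : n.-tuple X) (t : tens X Y) :
  basis_of fullv e -> t = \sum_(i < n) e`_i ⊗ lcomp Y e i t.
Proof.
move=> be; have L : linear (fun t : tens X Y => \sum_(i < n) e`_i ⊗ lcomp Y e i t).
  move=> a u v /=; rewrite scaler_sumr -big_split /=; apply: eq_bigr => i _.
  by rewrite linearP tmul_linearr.
rewrite -[RHS](linfunE_linear L) -[LHS]id_lfunE; congr (fun_of_lfun _ t).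
apply: tens_ext => x y; rewrite id_lfunE linfunE_linear //.
rewrite [in LHS](coord_basis be (memvf x)) tmul_suml; apply: eq_bigr => i _.
by rewrite lcompE tmulZl tmulZr.
Qed.

Lemma tens_rcomp (e : n.-tuple Y) (t : tens X Y) :
  basis_of fullv e -> t = \sum_(i < n) rcomp X e i t ⊗ e`_i.
Proof.
move=> be; have L : linear (fun t : tens X Y => \sum_(i < n) rcomp X e i t ⊗ e`_i).
  move=> a u v /=; rewrite scaler_sumr -big_split /=; apply: eq_bigr => i _.
  by rewrite linearP tmul_linearl.
rewrite -[RHS](linfunE_linear L) -[LHS]id_lfunE; congr (fun_of_lfun _ t).
apply: tens_ext => x y; rewrite id_lfunE linfunE_linear //.
rewrite [in LHS](coord_basis be (memvf y)) tmul_sumr; apply: eq_bigr => i _.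
by rewrite rcompE tmulZl tmulZr.
Qed.

Lemma lcomp_sum (e : n.-tuple X) (y : 'I_n -> Y) i :
  free e -> lcomp Y e i (\sum_(j < n) e`_j ⊗ y j) = y i.
Proof.
move=> fe; rewrite linear_sum (bigD1 i) //= lcompE coord_free // eqxx scale1r.
rewrite big1 ?addr0 // => j ne; rewrite lcompE coord_free // (negPf ne); exact: scale0r.
Qed.

End TensorLinear.

End LinearAlgebra.

(** * Exterior powers of a 3-dimensional space *)

Section ExteriorPowers.
Variable K : numFieldType.
Implicit Types X Y W Z : vectType K.

Lemma alt2E W (x y : W) : alt2 W (x ⊗ y) = x ⊗ y - y ⊗ x.
Proof.
rewrite /alt2 tliftE //; split=> [{}y|{}x] a u v /=;
  by rewrite tmul_linearl tmul_linearr scalerBr opprD addrACA.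
Qed.

Lemma alt3E W (u v w : W) : alt3 W (u ⊗ (v ⊗ w)) =
      (u ⊗ (v ⊗ w) + v ⊗ (w ⊗ u) + w ⊗ (u ⊗ v))
    - (u ⊗ (w ⊗ v) + w ⊗ (v ⊗ u) + v ⊗ (u ⊗ w)).
Proof.
have E a (p q p' q' : tens W (tens W W)) :
    (a *: p + p') - (a *: q + q') = a *: (p - q) + (p' - q').
  by rewrite scalerBr opprD addrACA.
have E3 a (p q r p' q' r' : tens W (tens W W)) :
    (a *: p + p') + (a *: q + q') + (a *: r + r')
    = a *: (p + q + r) + (p' + q' + r').
  by rewrite !scalerDr [X in X + _ = _]addrACA [LHS]addrACA.
rewrite /alt3 tlift3E //; split=> b c a p q /=;
  by rewrite !(tmul_linearl, tmul_linearr) E3 E3 E.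
Qed.

Lemma vsval_wedge2 W (x y : W) : vsval (wedge2 x y) = x ⊗ y - y ⊗ x.
Proof. by rewrite /wedge2 vsprojK ?memv_img ?memvf // alt2E. Qed.

Lemma wedge2_linearl W (y : W) : linear (fun x => wedge2 x y).
Proof. by move=> a u v; rewrite /wedge2 tmul_linearl !linearP. Qed.

Lemma wedge2_linearr W (x : W) : linear (wedge2 x).
Proof. by move=> a u v; rewrite /wedge2 tmul_linearr !linearP. Qed.

Lemma wedge2xx W (x : W) : wedge2 x x = 0.
Proof. by apply: subvs_inj; rewrite vsval_wedge2 subrr. Qed.

Lemma wedge2C W (x y : W) : wedge2 y x = - wedge2 x y.
Proof. by apply: subvs_inj; rewrite linearN /= !vsval_wedge2 opprB. Qed.

Lemma wedge3_trilinear W : trilinear (@wedge3 K W).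
Proof.
by split=> x y a u v; rewrite /wedge3 !(tmul_linearl, tmul_linearr) !linearP.
Qed.

Lemma wedge3_alternating W (x y : W) :
  [/\ wedge3 x x y = 0, wedge3 x y y = 0 & wedge3 x y x = 0].
Proof.
rewrite /wedge3 !alt3E; split.
- by rewrite -[X in X - _]addrA [X in X - _]addrC subrr linear0.
- by rewrite subrr linear0.
by rewrite [X in X - _]addrC addrA subrr linear0.
Qed.

Lemma wedge3_swap12 W (x y z : W) : wedge3 y x z = - wedge3 x y z.
Proof.
rewrite /wedge3 !alt3E -linearN opprB; congr (vsproj _ (_ - _)).
  by rewrite -[LHS]addrA [LHS]addrC.
by rewrite [LHS]addrC addrA.
Qed.

Lemma wedge3_swap23 W (x y z : W) : wedge3 x z y = - wedge3 x y z.
Proof.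
by rewrite /wedge3 !alt3E -linearN opprB.
Qed.

(** The wedges span: composing the antisymmetrizer with the projection onto [S] does not change it
    on pure tensors, hence nowhere, so its whole image lies in [S]. *)
Lemma ext2_mem W (S : {vspace ext2 W}) (t : ext2 W) :
  (forall x y, wedge2 x y \in S) -> t \in S.
Proof.
move=> mS; have [u _ Eu] := memv_imgP (subvsP t).
have -> : t = linfun (vsproj (limg (alt2 W))) (alt2 W u) by rewrite lfunE /= -Eu vsvalK.
have E : (projv S \o (linfun (vsproj (limg (alt2 W))) \o alt2 W)
          = linfun (vsproj (limg (alt2 W))) \o alt2 W)%VF.
  by apply: tens_ext => x y; rewrite !comp_lfunE lfunE /= projv_id // mS.
by rewrite -[X in X \in _]comp_lfunE -E !comp_lfunE memv_proj.
Qed.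

Lemma ext3_mem W (S : {vspace ext3 W}) (t : ext3 W) :
  (forall x y z, wedge3 x y z \in S) -> t \in S.
Proof.
move=> mS; have [u _ Eu] := memv_imgP (subvsP t).
have -> : t = linfun (vsproj (limg (alt3 W))) (alt3 W u) by rewrite lfunE /= -Eu vsvalK.
have E : (projv S \o (linfun (vsproj (limg (alt3 W))) \o alt3 W)
          = linfun (vsproj (limg (alt3 W))) \o alt3 W)%VF.
  by apply: tens3_ext => x y z; rewrite !comp_lfunE lfunE /= projv_id // mS.
by rewrite -[X in X \in _]comp_lfunE -E !comp_lfunE memv_proj.
Qed.

Lemma ext2_ext W Z (f g : 'Hom(ext2 W, Z)) :
  (forall x y, f (wedge2 x y) = g (wedge2 x y)) -> f = g.
Proof.
move=> fg; apply/lfunP => t; apply/eqlfunP.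
by apply: ext2_mem => x y; apply/eqlfunP.
Qed.

Lemma tens_ext2_ext W X Z (f g : 'Hom(tens (ext2 W) X, Z)) :
  (forall x y z, f (wedge2 x y ⊗ z) = g (wedge2 x y ⊗ z)) -> f = g.
Proof.
move=> fg; apply: tens_ext => w z.
have L (h : 'Hom(tens (ext2 W) X, Z)) : linear (fun w => h (w ⊗ z)).
  by move=> c p q; rewrite tmul_linearl linearP.
rewrite -[LHS](linfunE_linear (L f)) -[RHS](linfunE_linear (L g)).
by congr (fun_of_lfun _ w); apply: ext2_ext => x y; rewrite !linfunE_linear.
Qed.

Lemma ext3_ext W Z (f g : 'Hom(ext3 W, Z)) :
  (forall x y z, f (wedge3 x y z) = g (wedge3 x y z)) -> f = g.
Proof.
move=> fg; apply/lfunP => t; apply/eqlfunP.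
by apply: ext3_mem => x y z; apply/eqlfunP.
Qed.

Lemma wedge12E W (x y z : W) : wedge12 x (wedge2 y z) = wedge3 x y z.
Proof.
have [_ l2 l3] := @wedge3_trilinear W.
by rewrite /wedge12 ext2_liftE // => u; have [_ ? _] := wedge3_alternating x u.
Qed.

Lemma wedge12_linearl W (a : ext2 W) : linear (fun x => wedge12 x a).
Proof.
move=> c u v; pose L x : 'Hom(ext2 W, ext3 W) := ext2_lift (wedge3 x).
have -> : wedge12 (c *: u + v) a = L (c *: u + v) a by [].
have -> : L (c *: u + v) = c *: L u + L v.
  apply: ext2_ext => y z; rewrite add_lfunE scale_lfunE.
  have [l _ _] := @wedge3_trilinear W.
  have LE x : L x (wedge2 y z) = wedge3 x y z by exact: wedge12E.
  by rewrite !LE; exact: l.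
by rewrite add_lfunE scale_lfunE.
Qed.

Lemma wedge12_linearr W (x : W) : linear (wedge12 x).
Proof. by move=> c u v; rewrite /wedge12 linearP. Qed.

Lemma linear_basis_mem n X Y (e : n.-tuple X) (f : X -> Y) (S : {vspace Y}) :
    basis_of fullv e -> linear f -> (forall i : 'I_n, f e`_i \in S) ->
  forall x, f x \in S.
Proof.
move=> be lf fe x; rewrite (coord_basis be (memvf x)) -(linfunE_linear lf) linear_sum.
by apply: memv_suml => i _; rewrite linearZ memvZ //= (linfunE_linear lf).
Qed.

Section Basis3.
Variables (W : vectType K) (e : 3.-tuple W).
Hypothesis be : basis_of fullv e.

(** By trilinearity only the 27 wedges of basis vectors matter: those with a repetition vanish, the
    others are the generator up to sign. Identities of linear maps on Λ³W thus reduce to one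
    evaluation. *)
Lemma wedge3_span (t : ext3 W) : t \in <[wedge3 e`_0 e`_1 e`_2]>%VS.
Proof.
apply: ext3_mem => x y z; set w := wedge3 _ _ e`_2.
have [l1 l2 l3] := @wedge3_trilinear W.
have ew : w \in <[w]>%VS by exact: memv_line.
have e3 u v : [/\ wedge3 u u v \in <[w]>%VS, wedge3 u v v \in <[w]>%VS
                & wedge3 u v u \in <[w]>%VS].
  by have [-> -> ->] := wedge3_alternating u v; rewrite mem0v.
move: x y z.
suff H (i j k : 'I_3) : wedge3 e`_i e`_j e`_k \in <[w]>%VS.
  move=> x y z; apply: (linear_basis_mem be (l1 _ _)) => i.
  apply: (linear_basis_mem be (l2 _ _)) => j.
  by apply: (linear_basis_mem be (l3 _ _)) => k.
suff: (i < 3 -> j < 3 -> k < 3 -> wedge3 e`_i e`_j e`_k \in <[w]>%VS)%N.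
  by apply; [exact: ltn_ord i | exact: ltn_ord j | exact: ltn_ord k].
move: (nat_of_ord i) (nat_of_ord j) (nat_of_ord k) => {}i {}j {}k.
have A2 := @wedge3_swap12 W; have A3 := @wedge3_swap23 W.
case: i j k => [|[|[|?]]] [|[|[|?]]] [|[|[|?]]] //= _ _ _;
  try by [have [] := e3 e`_0 e`_1 | have [] := e3 e`_0 e`_2 | have [] := e3 e`_1 e`_2
   | have [] := e3 e`_1 e`_0 | have [] := e3 e`_2 e`_0 | have [] := e3 e`_2 e`_1
   | have [] := e3 e`_0 e`_0 | have [] := e3 e`_1 e`_1 | have [] := e3 e`_2 e`_2].
- by rewrite (A3 e`_0 e`_1) memvN.
- by rewrite (A2 e`_0 e`_1) memvN.
- by rewrite (A3 e`_1 e`_0) (A2 e`_0 e`_1) opprK.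
- by rewrite (A2 e`_0 e`_2) (A3 e`_0 e`_1) opprK.
by rewrite (A2 e`_1 e`_2) (A3 e`_1 e`_0) (A2 e`_0 e`_1) opprK memvN.
Qed.

(** The cyclic order makes this family dual to [e] under the wedge pairing without signs. *)
Definition wedge_basis : 3.-tuple (ext2 W) :=
  [tuple wedge2 e`_1 e`_2; wedge2 e`_2 e`_0; wedge2 e`_0 e`_1].

Lemma wedge2_span : <<wedge_basis>>%VS = fullv.
Proof.
apply/eqP; rewrite eqEsubv subvf; apply/subvP => t _.
apply: ext2_mem => x y.
apply: (linear_basis_mem be (@wedge2_linearl _ _)) => i.
apply: (linear_basis_mem be (@wedge2_linearr _ _)) => j.
have m (k : 'I_3) : wedge_basis`_k \in <<wedge_basis>>%VS.
  by rewrite memv_span // mem_nth // size_tuple.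
have m0 := m 0; have m1 := m 1; have m2 := m (inord 2); rewrite /= inordK //= in m0 m1 m2.
have := ltn_ord i; have := ltn_ord j.
move: (nat_of_ord i) (nat_of_ord j) => {}i {}j.
case: i j => [|[|[|?]]] [|[|[|?]]] //= _ _; rewrite ?wedge2xx ?mem0v //.
- by rewrite wedge2C memvN.
- by rewrite wedge2C memvN.
by rewrite wedge2C memvN.
Qed.

End Basis3.

End ExteriorPowers.

(** * Duality of volume forms *)

Section DualDelta.
Variable K : numFieldType.
Variables (X Y : vectType K) (p : X -> Y -> K).
Hypothesis pl : forall y, scalar (fun x => p x y).
Hypothesis pr : forall x, scalar (p x).

Let D (x0 x1 x2 : X) (y0 y1 y2 : Y) : K^o :=
  \det (\matrix_(i < 3, j < 3)
          p (tnth [tuple x0; x1; x2] i) (tnth [tuple y0; y1; y2] j)).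

(** With the determinant expanded, its multilinearity and alternation in either triple become ring
    identities. *)
Lemma det_pairing3 x0 x1 x2 y0 y1 y2 : D x0 x1 x2 y0 y1 y2 =
    p x0 y0 * (p x1 y1 * p x2 y2 - p x1 y2 * p x2 y1)
  - p x0 y1 * (p x1 y0 * p x2 y2 - p x1 y2 * p x2 y0)
  + p x0 y2 * (p x1 y0 * p x2 y1 - p x1 y1 * p x2 y0).
Proof.
rewrite /D (expand_det_row _ 0) !big_ord_recr big_ord0 /= /cofactor.
rewrite !(expand_det_row _ 0) !big_ord_recr !big_ord0 /= /cofactor !det_mx11.
rewrite !mxE !(tnth_nth x0) !(tnth_nth y0) /= /bump /=.
ring.
Qed.

Let Dx_trilinear y0 y1 y2 : trilinear (fun x0 x1 x2 => D x0 x1 x2 y0 y1 y2).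
Proof. by split=> ? ? a u v; rewrite !det_pairing3 !pl scaleKE; ring. Qed.

Let Dy_trilinear x0 x1 x2 : trilinear (D x0 x1 x2).
Proof. by split=> ? ? a u v; rewrite !det_pairing3 !pr scaleKE; ring. Qed.

Let Dx_alternating x x' y0 y1 y2 :
  [/\ D x x x' y0 y1 y2 = 0, D x x' x' y0 y1 y2 = 0 & D x x' x y0 y1 y2 = 0].
Proof. by split; rewrite det_pairing3; ring. Qed.

Let Dy_alternating x0 x1 x2 y y' :
  [/\ D x0 x1 x2 y y y' = 0, D x0 x1 x2 y y' y' = 0 & D x0 x1 x2 y y' y = 0].
Proof. by split; rewrite det_pairing3; ring. Qed.

Lemma det_pairingE x0 x1 x2 y0 y1 y2 :
  det_pairing p (wedge3 y0 y1 y2) (wedge3 x0 x1 x2) = D x0 x1 x2 y0 y1 y2.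
Proof.
have LE y0' y1' y2' x0' x1' x2' :
    ext3_lift (fun x0 x1 x2 => D x0 x1 x2 y0' y1' y2') (wedge3 x0' x1' x2')
    = D x0' x1' x2' y0' y1' y2'.
  by rewrite ext3_liftE.
have Dy := Dy_trilinear.
rewrite /det_pairing ext3_liftE; first exact: LE.
  split=> ? ? a u v; apply: ext3_ext => a0 a1 a2; rewrite add_lfunE scale_lfunE !LE;
  by have [l1 l2 l3] := Dy a0 a1 a2; rewrite ?(l1, l2, l3).
move=> y y'; split; apply: ext3_ext => a0 a1 a2; rewrite LE zero_lfunE;
by have [? ? ?] := Dy_alternating a0 a1 a2 y y'.
Qed.

(** The determinant pairing sends the wedge of [y] to a form on the line Λ³X, which is compared with
    [delta] on the wedge of [x]: the former takes there the determinant of the identity matrix, the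
    latter the value 1 by hypothesis. *)
Lemma dual_deltaE (x : 3.-tuple X) (y : 3.-tuple Y) (delta : 'Hom(ext3 X, K^o)) :
    basis_of fullv x -> (forall i j : 'I_3, p x`_i y`_j = (i == j)%:R) ->
    delta (wedge3 x`_0 x`_1 x`_2) = 1 ->
  dual_delta p delta (wedge3 y`_0 y`_1 y`_2) = 1.
Proof.
move=> bx pxy d1; rewrite /dual_delta comp_lfunE.
have sc_lin : linear (fun c : K^o => (c : K) *: delta : vdual (ext3 X)).
  by move=> a u v; rewrite scalerDl scalerA.
set L := linfun _; have LE c : L c = (c : K) *: delta by exact: (linfunE_linear sc_lin).
suff -> : det_pairing p (wedge3 y`_0 y`_1 y`_2) = L 1.
  (* [L] is injective because [delta] takes the value 1, so its formal inverse is a genuine left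
     inverse. *)
  rewrite lker0_lfunK //; apply/lker0P/lfun_inj => c.
  rewrite LE => /(congr1 (fun f : vdual _ => f (wedge3 x`_0 x`_1 x`_2))).
  by rewrite scale_lfunE d1 zero_lfunE [c *: _]mulr1.
rewrite LE; apply/lfunP => t; have /vlineP[c ->] := wedge3_span bx t.
rewrite scale1r !linearZ /= d1 det_pairingE det_pairing3; congr (_ *: _).
have E (i j : 'I_3) : p x`_i y`_j = (i == j)%:R by exact: pxy.
have := (E 0 0, E 0 1, E 0 (inord 2), E 1 0, E 1 1, E 1 (inord 2),
         E (inord 2) 0, E (inord 2) 1, E (inord 2) (inord 2)).
rewrite -!val_eqE /= !inordK //= => E'; rewrite !E'; ring.
Qed.

End DualDelta.

Lemma delta_bijective (K : numFieldType) (W : vectType K) (e : 3.-tuple W)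
    (delta : 'Hom(ext3 W, K^o)) :
  basis_of fullv e -> delta (wedge3 e`_0 e`_1 e`_2) = 1 -> bijective delta.
Proof.
move=> be d1; exists (fun c : K^o => (c : K) *: wedge3 e`_0 e`_1 e`_2) => [t|c].
  by have /vlineP[c ->] := wedge3_span be t; rewrite linearZ /= d1 [(_ *: 1)]mulr1.
by rewrite linearZ /= d1 [LHS]mulr1.
Qed.

(** * Bases of volume one *)

Section Frames.
Variable K : numFieldType.

Definition frame (T : quintuple K) (e : 3.-tuple (qW T)) :=
  basis_of fullv e /\ qdelta T (wedge3 e`_0 e`_1 e`_2) = 1.

Lemma exists_frame (T : quintuple K) :
  \dim {:qW T} = 3%N -> bijective (qdelta T) -> exists e : 3.-tuple (qW T), frame e.
Proof.
move=> dW [g dK gK].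
pose b := tcast dW (vbasis {:qW T}).
have bb : basis_of fullv b by rewrite /basis_of val_tcast; exact: vbasisP.
(* [g 1] has volume 1, so its coefficient [c] on the wedge of [b] is the factor by which one basis
   vector must be rescaled. *)
have [c Ec] := vlineP _ _ (wedge3_span bb (g 1)).
have c0 : qdelta T (wedge3 b`_0 b`_1 b`_2) * c = 1.
  by rewrite mulrC -[LHS]linearZ /= -Ec gK.
have cn : c != 0 by apply: contraTneq (oner_neq0 K) => E; rewrite -c0 E mulr0 eqxx.
exists [tuple c *: b`_0; b`_1; b`_2]; split.
  have /freeP fb := basis_free bb.
  apply: free_basis_of => //; apply/freeP => k; rewrite !big_ord_recr big_ord0 /= add0r => E.
  (* A relation among the rescaled vectors is a relation among those of [b] with coefficients
     [k']. *)
  pose k' i := if i == 0 then k i * c else k i.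
  have k0 i : k' i = 0.
    by apply: fb; rewrite !big_ord_recr big_ord0 /= add0r {1}/k' /= -scalerA E.
  move=> i; have := k0 i; rewrite /k'; case: eqP => // _ /eqP.
  by rewrite mulf_eq0 (negPf cn) orbF => /eqP.
have [l1 _ _] := @wedge3_trilinear K (qW T).
have w0 : wedge3 0 b`_1 b`_2 = 0 by rewrite /wedge3 tmul0l !linear0.
have := l1 b`_1 b`_2 c b`_0 0; rewrite !addr0 /= w0 addr0 => ->.
by rewrite linearZ /= -c0 mulrC.
Qed.

End Frames.

(** * The construction in a basis of volume one *)

Section Frame.
Variables (K : numFieldType) (T : quintuple K) (e : 3.-tuple (qW T)).
Hypothesis fe : frame e.
Let be : basis_of fullv e := fe.1.
Let d1 : qdelta T (wedge3 e`_0 e`_1 e`_2) = 1 := fe.2.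
Local Notation a := (wedge_basis e).

Lemma cross_pairing_scalarl (b : cross_W T) : scalar (fun x => cross_pairing x b).
Proof. by move=> c u v; rewrite /cross_pairing wedge12_linearl linearP. Qed.

Lemma cross_pairing_scalarr (x : qW T) : scalar (cross_pairing x).
Proof. by move=> c u v; rewrite /cross_pairing wedge12_linearr linearP. Qed.

Lemma cross_pairing_frame (i j : 'I_3) : cross_pairing (T := T) e`_i a`_j = (i == j)%:R.
Proof.
have E (x y z : qW T) : cross_pairing (T := T) x (wedge2 y z) = qdelta T (wedge3 x y z).
  by rewrite /cross_pairing wedge12E.
have Z (x y : qW T) : [/\ qdelta T (wedge3 x x y) = 0, qdelta T (wedge3 x y y) = 0 &
    qdelta T (wedge3 x y x) = 0].
  by have [-> -> ->] := wedge3_alternating x y; rewrite linear0.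
rewrite -val_eqE /=; have := ltn_ord i; have := ltn_ord j.
move: (nat_of_ord i) (nat_of_ord j) => {}i {}j.
case: i j => [|[|[|?]]] [|[|[|?]]] //= _ _; rewrite E.
- exact: d1.
- by have [] := Z e`_0 e`_2.
- by have [] := Z e`_0 e`_1.
- by have [] := Z e`_1 e`_2.
- by rewrite (wedge3_swap23 e`_1) (wedge3_swap12 e`_0) opprK d1.
- by have [] := Z e`_1 e`_0.
- by have [] := Z e`_2 e`_1.
- by have [] := Z e`_2 e`_0.
by rewrite (wedge3_swap12 e`_0) (wedge3_swap23 e`_0) opprK d1.
Qed.

Lemma cross_W_dualityE b x : cross_W_duality T b x = cross_pairing x b.
Proof.
rewrite (linfun_vdualE (p := fun b x => cross_pairing x b)) // => y.
  exact: cross_pairing_scalarr.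
exact: cross_pairing_scalarl.
Qed.

Lemma cross_W_codualE x b : cross_W_codual T x b = cross_pairing x b.
Proof.
rewrite (linfun_vdualE (p := fun x b => cross_pairing x b)) // => y.
  exact: cross_pairing_scalarl.
exact: cross_pairing_scalarr.
Qed.

Lemma wedge_basisP : basis_of fullv a.
Proof.
have fa : free a.
  apply: (@dual_basis_free _ _ _ _ (fun i => cross_W_codual T e`_i)) => i j.
  by rewrite cross_W_codualE cross_pairing_frame.
by apply/andP; split; rewrite // wedge2_span.
Qed.

Lemma dim_qW : \dim {:qW T} = 3%N. Proof. exact: vector.size_basis be. Qed.

Lemma dim_cross_W : \dim {:cross_W T} = 3%N. Proof. exact: vector.size_basis wedge_basisP. Qed.

Lemma cross_W_duality_bij : bijective (cross_W_duality T).
Proof.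
apply: injective_bijective; first by rewrite dim_vdual dim_cross_W dim_qW.
apply: lfun_inj => b E; rewrite (coord_basis wedge_basisP (memvf b)).
apply: big1 => i _; suff -> : coord a i b = 0 by rewrite scale0r.
have := cross_W_dualityE b e`_i; rewrite E zero_lfunE => ->.
have L := cross_pairing_scalarr e`_i.
rewrite -(cross_W_codualE) [in RHS](coord_basis wedge_basisP (memvf b)) linear_sum.
rewrite (bigD1 i) //= big1 ?addr0 => [|j ne];
  rewrite linearZ /= cross_W_codualE cross_pairing_frame.
  by rewrite eqxx [RHS]mulr1.
by rewrite eq_sym (negPf ne) [LHS]mulr0.
Qed.

Lemma cross_W_codual_bij : bijective (cross_W_codual T).
Proof.
apply: injective_bijective; first by rewrite dim_vdual dim_cross_W dim_qW.
apply: lfun_inj => x E; rewrite (coord_basis be (memvf x)).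
apply: big1 => i _; suff -> : coord e i x = 0 by rewrite scale0r.
have : cross_W_codual T x a`_i = 0 by rewrite E zero_lfunE.
rewrite [x in X in X -> _](coord_basis be (memvf x)) linear_sum sum_lfunE (bigD1 i) //=.
rewrite linearZ scale_lfunE /= cross_W_codualE cross_pairing_frame eqxx scaleKE mulr1.
rewrite big1 ?addr0 // => j ne; rewrite linearZ scale_lfunE /= cross_W_codualE.
by rewrite cross_pairing_frame (negPf ne) scaleKE mulr0.
Qed.

Lemma VW_dualE v b x xi :
  VW_dual T (v ⊗ b) (x ⊗ xi) = (xi v : K) * cross_pairing x b.
Proof.
have bil v' b' : bilinear_for *:%R *:%R
    (fun (x : qW T) (xi : vdual (qV T)) => (xi v' : K) * cross_pairing x b' : K^o).
  split=> [y|y] c p q /=.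
    by rewrite cross_pairing_scalarl mulrDr mulrCA.
  by rewrite add_lfunE scale_lfunE !scaleKE mulrDl mulrA.
rewrite /VW_dual tliftE ?tliftE //.
split=> [y|y] c p q; apply: tens_ext => x' xi'; rewrite add_lfunE scale_lfunE !tliftE //.
  by rewrite linearP /= !scaleKE mulrDl mulrA.
by rewrite cross_pairing_scalarr mulrDr mulrCA.
Qed.

(** Dimensions agree, and evaluating the image of a tensor at e_i ⊗ ξ returns ξ of its V-component
    along a_i, so no nonzero tensor is killed. *)
Lemma VW_dual_bij : bijective (VW_dual T).
Proof.
apply: injective_bijective.
  by rewrite dim_vdual !dim_tens dim_vdual dim_cross_W dim_qW mulnC.
apply: lfun_inj => t E; rewrite (tens_rcomp t wedge_basisP).
apply: big1 => i _; suff -> : rcomp (qV T) a i t = 0 by rewrite tmul0l.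
apply: vdual_eq0 => xi; have : VW_dual T t (e`_i ⊗ xi) = 0 by rewrite E zero_lfunE.
rewrite [t in X in X -> _](tens_rcomp t wedge_basisP) linear_sum sum_lfunE (bigD1 i) //=.
rewrite VW_dualE cross_pairing_frame eqxx mulr1 big1 ?addr0 // => j ne.
by rewrite VW_dualE cross_pairing_frame eq_sym (negPf ne) mulr0.
Qed.

Lemma cross_delta_frame : cross_delta T (wedge3 a`_0 a`_1 a`_2) = 1.
Proof.
apply: dual_deltaE d1 => //.
- exact: cross_pairing_scalarl.
- exact: cross_pairing_scalarr.
exact: cross_pairing_frame.
Qed.

(** The images of the e_i are the basis dual to the a_i, which have volume 1 for [cross_delta];
    duality of volume forms applies a second time. *)
Lemma codual_frame : frame (T := cross_involution T) (map_tuple (cross_W_codual T) e).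
Proof.
set e1 := map_tuple _ _.
have e1E (i : 'I_3) : e1`_i = cross_W_codual T e`_i.
  by rewrite (nth_map 0) // size_tuple.
have e1a (i j : 'I_3) : e1`_j a`_i = (i == j)%:R.
  by rewrite e1E cross_W_codualE cross_pairing_frame eq_sym.
split.
  apply: free_basis_of; last by rewrite dim_vdual dim_cross_W.
  apply: (@dual_basis_free _ _ _ _ (fun i => vdual_ev _ a`_i)) => i j.
  by rewrite vdual_evE e1a.
apply: dual_deltaE cross_delta_frame => //.
- by move=> w c u v; rewrite linearP.
- by move=> w c u v; rewrite add_lfunE scale_lfunE.
exact: wedge_basisP.
Qed.

Lemma codual_delta x y z : qdelta (cross_involution T)
    (wedge3 (cross_W_codual T x) (cross_W_codual T y) (cross_W_codual T z))
  = qdelta T (wedge3 x y z).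
Proof.
set g := cross_W_codual T.
have lE x' y' z' : ext3_lift (fun x y z => wedge3 (g x) (g y) (g z)) (wedge3 x' y' z')
    = wedge3 (g x') (g y') (g z').
  rewrite ext3_liftE // => [|x0 y0]; last exact: wedge3_alternating.
  have [l1 l2 l3] := @wedge3_trilinear K (qW (cross_involution T)).
  by split=> ? ? c u v; rewrite linearP; [exact: l1 | exact: l2 | exact: l3].
(* Both sides are now linear forms on the line Λ³W', hence determined by their value on the wedge of
   [e]. *)
rewrite -lE; have /vlineP[c ->] := wedge3_span be (wedge3 x y z).
rewrite !linearZ /= lE d1; congr (_ *: _).
by have [_] := codual_frame; rewrite /= !(nth_map 0) ?size_tuple.
Qed.

End Frame.

(** * Equations of the kernel and the transformed tensor *)

Section Kernel.
Variables (K : numFieldType) (T : quintuple K) (e : 3.-tuple (qW T)).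
Hypothesis fe : frame e.
Let be : basis_of fullv e := fe.1.
Local Notation a := (wedge_basis e).
Local Notation slice := (lcomp (vdual (qV T)) a).

Lemma sum_I3 (X : nmodType) (F : 'I_3 -> X) : \sum_i F i = F 0 + F 1 + F ord_max.
Proof.
by rewrite !big_ord_recr big_ord0 /= add0r; congr (F _ + F _ + F _); apply: val_inj.
Qed.

Lemma Btilde_wedge2 x y xi :
  Btilde T (wedge2 x y ⊗ xi) = qB T (x ⊗ xi) ⊗ y - qB T (y ⊗ xi) ⊗ x.
Proof.
have b2 (xi' : vdual (qV T)) : bilinear_for *:%R *:%R
    (fun x y : qW T => qB T (x ⊗ xi') ⊗ y).
  by split=> z c u v; rewrite /= ?tmul_linearl ?linearP /= ?tmul_linearl ?tmul_linearr.
rewrite /Btilde comp_lfunE /tmap tliftE; last first.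
  by split=> z c u v; rewrite linearP /= ?tmul_linearl ?tmul_linearr.
rewrite id_lfunE ext2_inclE vsval_wedge2 tliftE; first by rewrite linearB /= !tliftE.
split=> [z|t] c u v; first by rewrite linearP.
pose L xi := tlift (fun x y : qW T => qB T (x ⊗ xi) ⊗ y).
suff : L (c *: u + v) = c *: L u + L v.
  by move=> E; rewrite -[LHS]/(L (c *: u + v) t) E add_lfunE scale_lfunE.
apply: tens_ext => x' y'; rewrite add_lfunE scale_lfunE !tliftE //.
by rewrite tmul_linearr linearP tmul_linearl.
Qed.

(** Writing [t] as Σ a_j ⊗ ξ_j, the coefficient of e_k in [Btilde T t] is the skew part of the 3 by
    3 matrix [B] in the two other indices. Hence [t] lies in the kernel exactly when [B] is
    symmetric. *)
Lemma Btilde_rcomp t (B := fun i j : 'I_3 => qB T (e`_i ⊗ slice j t)) :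
  [/\ rcomp (qU T) e 0 (Btilde T t) = B ord_max 1 - B 1 ord_max,
      rcomp (qU T) e 1 (Btilde T t) = B 0 ord_max - B ord_max 0
    & rcomp (qU T) e ord_max (Btilde T t) = B 1 0 - B 0 1].
Proof.
have ce j (k : 'I_3) : (j < 3)%N -> coord e k e`_j = (j == k :> nat)%:R.
  by move=> lj; rewrite (coord_free (Ordinal lj) k (basis_free be)).
have Et : Btilde T t =
    (qB T (e`_1 ⊗ slice 0 t) ⊗ e`_2 - qB T (e`_2 ⊗ slice 0 t) ⊗ e`_1)
  + (qB T (e`_2 ⊗ slice 1 t) ⊗ e`_0 - qB T (e`_0 ⊗ slice 1 t) ⊗ e`_2)
  + (qB T (e`_0 ⊗ slice ord_max t) ⊗ e`_1 - qB T (e`_1 ⊗ slice ord_max t) ⊗ e`_0).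
  by rewrite -!Btilde_wedge2 -!linearD /=; congr (Btilde T _);
     rewrite {1}(tens_lcomp t (wedge_basisP fe)) sum_I3.
have Ek y01 y02 y10 y11 y20 y21 (w := (y01 ⊗ e`_2 - y02 ⊗ e`_1)
    + (y10 ⊗ e`_0 - y11 ⊗ e`_2) + (y20 ⊗ e`_1 - y21 ⊗ e`_0)) :
  [/\ rcomp (qU T) e 0 w = y10 - y21, rcomp (qU T) e 1 w = y20 - y02
    & rcomp (qU T) e ord_max w = y01 - y11].
  rewrite !linearD !linearN /= !rcompE !ce //=; split; rewrite !scale0r !scale1r.
  - by rewrite subrr sub0r subr0 add0r.
  - by rewrite subrr sub0r subr0 addr0 addrC.
  by rewrite subrr sub0r subr0 addr0.
by rewrite Et; exact: Ek.
Qed.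

Lemma Btilde_kerP t (B := fun i j : 'I_3 => qB T (e`_i ⊗ slice j t)) :
  reflect [/\ B ord_max 1 = B 1 ord_max, B 0 ord_max = B ord_max 0 & B 1 0 = B 0 1]
    (t \in lker (Btilde T)).
Proof.
have [E0 E1 E2] : [/\ rcomp (qU T) e 0 (Btilde T t) = B ord_max 1 - B 1 ord_max,
      rcomp (qU T) e 1 (Btilde T t) = B 0 ord_max - B ord_max 0
    & rcomp (qU T) e ord_max (Btilde T t) = B 1 0 - B 0 1] by exact: Btilde_rcomp.
clearbody B.
rewrite memv_ker; apply: (iffP eqP) => [E|[D0 D1 D2]].
  by split; apply: subr0_eq; [rewrite -E0 | rewrite -E1 | rewrite -E2]; rewrite E linear0.
rewrite (tens_rcomp (Btilde T t) be) sum_I3 E0 E1 E2.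
by rewrite D0 D1 D2 !subrr !tmul0l !addr0.
Qed.

Lemma cross_BE (u : cross_U T) v :
  cross_B T (u ⊗ v) = \sum_i slice i (vsval u) v *: a`_i.
Proof.
have b2 (v' : qV T) : bilinear_for *:%R *:%R
    (fun (b : cross_W T) (xi : vdual (qV T)) => (xi v' : K) *: b).
  split=> z c p q /=; first by rewrite scalerDr !scalerA mulrC.
  by rewrite add_lfunE scale_lfunE scalerDl scalerA.
rewrite /cross_B tliftE; last first.
  split=> [z|w] c p q; first by rewrite linearP.
  pose L v' := tlift (fun (b : cross_W T) (xi : vdual (qV T)) => (xi v' : K) *: b).
  suff : L (c *: p + q) = c *: L p + L q.
    by move=> E; rewrite -[LHS]/(L (c *: p + q) (vsval w)) E add_lfunE scale_lfunE.
  apply: tens_ext => x' y'; rewrite add_lfunE scale_lfunE !tliftE //.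
  by rewrite linearP scalerDl scalerA.
rewrite [in LHS](tens_lcomp (vsval u) (wedge_basisP fe)) linear_sum.
by apply: eq_bigr => i _; rewrite /= (tliftE (b2 v)).
Qed.

Lemma cross_involution_BE (i : 'I_3) z (u : cross_U T) :
  qB (cross_involution T) (cross_W_codual T e`_i ⊗ z) u = z (slice i (vsval u)).
Proof.
(* [G] and [H] name the nested [linfun]s of [undual], which evaluate as expected only once the
   functions inside them are known to be linear. *)
pose G (w : vdual (cross_W T)) (u : cross_U T) : vdual (qV T) :=
  linfun (fun v => w (cross_B T (u ⊗ v))).
have GE w u' v : G w u' v = w (cross_B T (u' ⊗ v)).
  by rewrite /G linfunE_linear // => c p q; rewrite tmul_linearr !linearP.
have Gl w : linear (G w).
  by move=> c p q; apply/lfunP => v; rewrite add_lfunE scale_lfunE !GE tmul_linearl !linearP.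
have Gr u' : linear (fun w => G w u').
  by move=> c p q; apply/lfunP => v; rewrite !(add_lfunE, scale_lfunE, GE).
pose H (w : vdual (cross_W T)) (z : vdual (vdual (qV T))) : vdual (cross_U T) :=
  linfun (fun u => z (G w u)).
have HE w z' u' : H w z' u' = z' (G w u').
  by rewrite /H linfunE_linear // => c p q; rewrite Gl linearP.
have -> : qB (cross_involution T) = tlift H by [].
rewrite tliftE; last first.
  split=> [z'|w] c p q; apply/lfunP => u'; rewrite !(add_lfunE, scale_lfunE, HE) //.
  by rewrite Gr linearP.
rewrite HE; congr (z _); apply/lfunP => v; rewrite GE cross_BE linear_sum.
rewrite (bigD1 i) //= big1 ?addr0 => [|j ne];
  rewrite linearZ /= cross_W_codualE cross_pairing_frame //.
  by rewrite eqxx [LHS]mulr1.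
by rewrite eq_sym (negPf ne) [LHS]mulr0.
Qed.

End Kernel.

(** * Consequences of the main assumption *)

Section MainAssumption.
Variables (K : numFieldType) (T : quintuple K) (e : 3.-tuple (qW T)).
Hypothesis fe : frame e.
Hypothesis mT : main_assumption T.

Lemma dim_cross_U : \dim {:qU T} = 3%N -> \dim {:qV T} = 4%N -> \dim {:cross_U T} = 3%N.
Proof.
move=> dU dV; have := limg_ker_dim (Btilde T) fullv.
rewrite capfv mT !dim_tens dU dim_vdual dV (dim_qW fe) (dim_cross_W fe) dim_subvs_of.
(* Rank-nullity reads dim U + 9 = 3 · 4. *)
by move=> E; apply: (@addIn 9); rewrite E.
Qed.

(** The contraction [L] = b ⊗ id kills the image of [Btilde], since the latter is spanned by
    differences of tensors B'(x ⊗ ξ) ⊗ y. As [Btilde] is onto, b(y) e_0 = 0 for every y. *)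
Lemma qB_separated (b : vdual (qU T)) : (forall t, b (qB T t) = 0) -> b = 0.
Proof.
move=> b0; apply/lfunP => y; rewrite zero_lfunE.
pose L : 'Hom(tens (qU T) (qW T), qW T) := tlift (fun y w => (b y : K) *: w).
have LE y' w : L (y' ⊗ w) = (b y' : K) *: w.
  rewrite /L tliftE //; split=> z c p q; first by rewrite linearP scalerDl /= ?scaleKE scalerA.
  by rewrite /= scalerDr !scalerA mulrC.
have L0 : (L \o Btilde T)%VF = 0.
  apply: tens_ext2_ext => p q xi.
  by rewrite zero_lfunE comp_lfunE Btilde_wedge2 linearB /= !LE !b0 !scale0r subrr.
have /memv_imgP[t _ Et] : y ⊗ e`_0 \in limg (Btilde T) by rewrite mT memvf.
have := LE y e`_0; rewrite Et -comp_lfunE L0 zero_lfunE => /esym/eqP.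
have /negPf e0 : e`_0 != 0.
  by apply: free_not0 (basis_free fe.1) _; rewrite mem_nth // size_tuple.
by rewrite scaler_eq0 e0 orbF => /eqP.
Qed.

Lemma B_flat_inj : injective (B_flat T).
Proof.
rewrite /B_flat; set L := linfun _.
have LE b : L b = (b \o qB T)%VF.
  by rewrite /L linfunE_linear // => c p q; rewrite comp_lfunDl -comp_lfunZl.
have [g VK gV] := VW_dual_bij fe.
have kV : lker (VW_dual T) == 0%VS by apply/lker0P/(can_inj VK).
have imV t : t \in limg (VW_dual T) by rewrite -[t]gV memv_img ?memvf.
apply: lfun_inj => b; rewrite comp_lfunE => /(congr1 (VW_dual T)).
rewrite limg_lfunVK // linear0 LE => E; apply: qB_separated => t.
by rewrite -comp_lfunE E zero_lfunE.
Qed.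

End MainAssumption.

(** * Applying the construction twice *)

Section Double.
Variables (K : numFieldType) (T : quintuple K) (e : 3.-tuple (qW T)).
Hypothesis fe : frame e.
Hypothesis dU : \dim {:qU T} = 3%N.
Hypothesis dV : \dim {:qV T} = 4%N.
Hypothesis mT : main_assumption T.
Let T1 := cross_involution T.
Hypothesis mT1 : main_assumption T1.
Let e1 : 3.-tuple (qW T1) := map_tuple (cross_W_codual T) e.
Let fe1 : frame e1 := codual_frame fe.
Local Notation a1 := (wedge_basis e1).
Local Notation slice1 := (lcomp (vdual (qV T1)) a1).

Let e1E (i : 'I_3) : e1`_i = cross_W_codual T e`_i.
Proof. by rewrite (nth_map 0) // size_tuple. Qed.

Let slice_form (b : vdual (qU T)) (i : 'I_3) : vdual (qV T1) :=
  linfun (fun xi : vdual (qV T) => b (qB T (e`_i ⊗ xi))).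

Let slice_formE b i xi : slice_form b i xi = b (qB T (e`_i ⊗ xi)).
Proof. by rewrite /slice_form linfunE_linear // => c p q; rewrite tmul_linearr !linearP. Qed.

Let theta0 b : tens (ext2 (qW T1)) (vdual (qV T1)) := \sum_(i < 3) a1`_i ⊗ slice_form b i.

Let slice_theta0 b i : slice1 i (theta0 b) = slice_form b i.
Proof. by rewrite lcomp_sum // (basis_free (wedge_basisP fe1)). Qed.

(** Evaluated at an element u = Σ a_j ⊗ ξ_j of U, the symmetry equations for [theta0 b] are the
    images under [b] of those satisfied by u. *)
Let theta0_ker b : theta0 b \in lker (Btilde T1).
Proof.
apply/(Btilde_kerP fe1); rewrite !slice_theta0.
have key (u : cross_U T) (i j : 'I_3) :
    qB T (e`_i ⊗ lcomp (vdual (qV T)) (wedge_basis e) j (vsval u))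
    = qB T (e`_j ⊗ lcomp (vdual (qV T)) (wedge_basis e) i (vsval u)) ->
    qB T1 (e1`_i ⊗ slice_form b j) u = qB T1 (e1`_j ⊗ slice_form b i) u.
  by rewrite !e1E !cross_involution_BE // !slice_formE => ->.
split; apply/lfunP => u; apply: key;
  by have [E0 E1 E2] := Btilde_kerP fe _ (subvsP u).
Qed.

Let theta : 'Hom(vdual (qU T), cross_U T1) :=
  linfun (fun b => vsproj (lker (Btilde T1)) (theta0 b)).

Let thetaE b : vsval (theta b) = theta0 b.
Proof.
rewrite /theta linfunE_linear ?vsprojK // => c p q.
suff -> : theta0 (c *: p + q) = c *: theta0 p + theta0 q by rewrite linearP.
rewrite /theta0 scaler_sumr -big_split; apply: eq_bigr => i _ /=.
suff -> : slice_form (c *: p + q) i = c *: slice_form p i + slice_form q i.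
  by rewrite tmul_linearr.
by apply/lfunP => xi; rewrite !(add_lfunE, scale_lfunE, slice_formE).
Qed.

Let dU1 : \dim {:cross_U T1} = 3%N.
Proof.
apply: (dim_cross_U fe1 mT1); rewrite !dim_vdual //.
exact: (dim_cross_U fe mT).
Qed.

Let theta_bij : bijective theta.
Proof.
apply: injective_bijective; first by rewrite dim_vdual dU dU1.
apply: lfun_inj => b E; apply: (qB_separated fe mT) => t.
have Z (i : 'I_3) xi : b (qB T (e`_i ⊗ xi)) = 0 :> K.
  by rewrite -slice_formE -slice_theta0 -thetaE E linear0 zero_lfunE.
rewrite (tens_lcomp t fe.1) !linear_sum; apply: big1 => i _; exact: Z.
Qed.

Let theta_inv : 'Hom(cross_U T1, vdual (qU T)) := (theta^-1)%VF.

Let theta_invK b : theta_inv (theta b) = b.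
Proof. by rewrite lker0_lfunK //; apply/lker0P/bij_inj/theta_bij. Qed.

(** The transpose of [theta_inv], with U' identified with its bidual. *)
Let f : 'Hom(qU T, vdual (cross_U T1)) :=
  linfun (fun y => linfun (fun u => theta_inv u y : K^o) : vdual (cross_U T1)).

Let fE y u : f y u = theta_inv u y.
Proof.
rewrite (linfun_vdualE (p := fun y u => theta_inv u y)) // => z c p q.
  by rewrite linearP.
by rewrite linearP add_lfunE scale_lfunE.
Qed.

Lemma cross2_iso :
  exists f, quintuple_iso (T2 := cross_involution T1) f (cross2_W T) (cross2_V T).
Proof.
have gE x : cross2_W T x = cross_W_codual T1 (cross_W_codual T x).
  by rewrite /cross2_W comp_lfunE.
exists f; split.
- split.
  + apply: injective_bijective; first by rewrite dim_vdual dU dU1.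
    apply: lfun_inj => y E; apply: vdual_eq0 => b.
    by rewrite -[b]theta_invK -fE E zero_lfunE.
  + have [g gK Kg] := cross_W_codual_bij fe.
    have [g1 g1K Kg1] := cross_W_codual_bij fe1.
    exists (g \o g1) => x; rewrite gE /=; first by rewrite g1K gK.
    by rewrite Kg Kg1.
  exact: vdual_ev_bij.
- move=> x y z; rewrite !gE.
  exact: etrans (codual_delta fe1 _ _ _) (codual_delta fe x y z).
(* The compatibility with B' is linear in [x]; phrased as membership in the zero subspace, it can be
   checked on the basis [e]. *)
move=> x xi; apply/eqP; rewrite -subr_eq0 -memv0; move: x.
apply: (linear_basis_mem fe.1).
  move=> c p q.
  have -> : cross2_W T (c *: p + q) = c *: cross2_W T p + cross2_W T q by exact: linearP.
  by rewrite !tmul_linearl !linearP /= scalerDr addrACA.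
move=> i; rewrite memv0 subr_eq0; apply/eqP/lfunP => u.
rewrite fE gE -e1E.
have [b ->] : exists b, u = theta b.
  by have [g _ Kg] := theta_bij; exists (g u); rewrite Kg.
rewrite theta_invK cross_involution_BE // thetaE slice_theta0.
(* What remains is that ξ(z_i) equals z_i(ξ ∘ h) for [h = vdual_ev], which is clear once z_i is
   evaluation at a vector v. *)
have [v Ev] : exists v, slice_form b i = vdual_ev (qV T) v.
  by have [g _ Kg] := vdual_ev_bij (qV T); exists (g (slice_form b i)); rewrite Kg.
by rewrite -slice_formE Ev vdual_evE comp_lfunE.
Qed.

End Double.

(** * Openness of the main assumption *)

Section Open.
Import VectorInternalTheory.
Variable K : numFieldType.

Definition lfun_mx (Y Z : vectType K) (f : 'Hom(Y, Z)) : 'M[K]_(dim Y, dim Z) :=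
  \matrix_(i, j) v2r (f (r2v (delta_mx 0 i))) 0 j.

Lemma lfun_mxE (Y Z : vectType K) (f : 'Hom(Y, Z)) r : v2r (f (r2v r)) = r *m lfun_mx f.
Proof.
rewrite [in LHS](matrix_sum_delta r) big_ord1 !linear_sum mulmx_sum_row.
apply: eq_bigr => i _; rewrite !linearZ /=; congr (_ *: _).
by apply/rowP => j; rewrite !mxE.
Qed.

Lemma limg_fullP (Y Z : vectType K) (f : 'Hom(Y, Z)) :
  limg f = fullv <-> row_full (lfun_mx f).
Proof.
split=> [fT|/row_fullP[B BA]].
  have fs z : exists r, f (r2v r) == z.
    have /memv_imgP[y _ ->] : z \in limg f by rewrite fT memvf.
    by exists (v2r y); rewrite v2rK eqxx.
  apply/row_fullP; exists (\matrix_i xchoose (fs (r2v (delta_mx 0 i)))).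
  apply/row_matrixP => i; rewrite row_mul rowK -lfun_mxE.
  by rewrite (eqP (xchooseP (fs _))) r2vK rowE mulmx1.
apply/eqP; rewrite eqEsubv subvf; apply/subvP => z _.
suff -> : z = f (r2v (v2r z *m B)) by rewrite memv_img ?memvf.
by apply: (can_inj v2rK); rewrite lfun_mxE -mulmxA BA mulmx1.
Qed.

(** The row selections [g] need not be injective: a repeated row only gives a vanishing determinant.
    Conversely, an invertible selection yields a left inverse of [A]. *)
Lemma row_full_minorP m n (A : 'M[K]_(m, n)) :
  reflect (exists g : {ffun 'I_n -> 'I_m}, \det (rowsub g A) != 0) (row_full A).
Proof.
apply: (iffP idP) => [fA|[g]].
  exists (fullrankfun fA); rewrite -unitfE; exact: fullrowsub_unit.
rewrite -unitfE -[_ \in _]/(rowsub g A \in unitmx) => uA.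
apply/row_fullP; exists (invmx (rowsub g A) *m rowsub g 1%:M).
by rewrite -mulmxA -rowsubE mulVmx.
Qed.

Lemma zariski_open_surjective (X Y Z : vectType K) (L : X -> 'Hom(Y, Z)) :
  linear L -> zariski_open (fun x => limg (L x) = fullv).
Proof.
move=> lL; pose b := vbasis {:X}.
(* [P] is the generic matrix of the family: its entries are linear forms in the coordinates of [x],
   and its maximal minors are the polynomials sought. *)
pose P : 'M[{mpoly K[\dim {:X}]}]_(dim Y, dim Z) :=
  \matrix_(i, j) \sum_(k < \dim {:X}) (lfun_mx (L b`_k) i j) *: 'X_k.
have PE x : map_mx (meval (fun k => coord b k x)) P = lfun_mx (L x).
  have -> : L x = \sum_(k < \dim {:X}) coord b k x *: L b`_k.
    rewrite {1}(coord_vbasis (memvf x)) -[LHS](linfunE_linear lL) linear_sum.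
    by apply: eq_bigr => k _; rewrite linearZ /= (linfunE_linear lL).
  apply/matrixP => i j; rewrite !mxE raddf_sum sum_lfunE linear_sum summxE.
  apply: eq_bigr => k _.
  by rewrite /= mevalZ mevalXU scale_lfunE linearZ !mxE mulrC.
exists [seq \det (rowsub g P) | g : {ffun 'I_(dim Z) -> 'I_(dim Y)}] => x.
have dE (g : {ffun 'I_(dim Z) -> 'I_(dim Y)}) :
    (\det (rowsub g P)).@[fun k => coord b k x] = \det (rowsub g (lfun_mx (L x))).
  by rewrite -PE -map_mxsub det_map_mx.
rewrite limg_fullP; split=> [/row_full_minorP[g dg]|[_ /codomP[g ->] dg]].
  by exists (\det (rowsub g P)); rewrite ?codom_f // dE.
by apply/row_full_minorP; exists g; rewrite -dE.
Qed.

Lemma Btilde_linear (U W V : vectType K) (delta : 'Hom(ext3 W, K^o)) :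
  linear (fun B : 'Hom(tens W (vdual V), U) =>
    Btilde (Quintuple delta B) : 'Hom(tens (ext2 W) (vdual V), tens U W)).
Proof.
move=> c B B'; pose D B : 'Hom(tens (ext2 W) (vdual V), tens U W) :=
  Btilde (Quintuple delta B).
have DE B0 (x y : W) (xi : vdual V) :
    D B0 (wedge2 x y ⊗ xi) = B0 (x ⊗ xi) ⊗ y - B0 (y ⊗ xi) ⊗ x.
  exact: (@Btilde_wedge2 _ (Quintuple delta B0)).
rewrite -[LHS]/(D (c *: B + B')) -[RHS]/(c *: D B + D B').
apply: tens_ext2_ext => x y xi; rewrite add_lfunE scale_lfunE !DE.
by rewrite !add_lfunE !scale_lfunE !tmul_linearl scalerBr opprD addrACA.
Qed.

End Open.

Theorem mainTheorem5 (R : realType) (U' W' V : vectType R[i])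
    (hU' : \dim {:U'} = 3%N) (hW' : \dim {:W'} = 3%N) (hV : \dim {:V} = 4%N)
    (delta' : 'Hom(ext3 W', R[i]^o)) (hdelta' : bijective delta') :
  zariski_open (fun B' : 'Hom(tens W' (vdual V), U') =>
                  main_assumption (Quintuple delta' B'))
  /\ forall B' : 'Hom(tens W' (vdual V), U'),
     let T := Quintuple delta' B' in
     bijective (cross_W_duality T)
     /\ bijective (VW_dual T)
     /\ (main_assumption T ->
         [/\ \dim {:cross_U T} = 3%N,
             injective (B_flat T),
             dtype334 (cross T),
             type334 (cross_involution T)
           & main_assumption (cross_involution T) ->
             exists f, quintuple_iso f (cross2_W T) (cross2_V T)]).
Proof.
split; first exact: zariski_open_surjective (@Btilde_linear _ _ _ _ delta').
move=> B' T; have [e fe] := @exists_frame _ T hW' hdelta'.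
have fe1 := codual_frame fe.
split; first exact: cross_W_duality_bij fe.
split=> [|mT]; first exact: VW_dual_bij fe.
have dU1 := dim_cross_U fe mT hU' hV.
split=> //.
- exact: B_flat_inj fe mT.
- split=> //; first exact: dim_cross_W fe.
    by rewrite dim_vdual.
  exact: delta_bijective (wedge_basisP fe) (cross_delta_frame fe).
- split; rewrite ?dim_vdual //; first exact: dim_cross_W fe.
  exact: delta_bijective fe1.1 fe1.2.
exact: cross2_iso fe hU' hV mT.
Qed.
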